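(* Let $\{X_n\}_{n\in\mathbf{Z}}$ be a stationary process. Then the following two conditions are equivalent: (i) $\{X_n\}$ is nondeterministic and $H_{(-\infty,-1]}\cap H_{[-n,\infty)}=H_{[-n,-1]}$ for every $n=1,2,\ldots$; (ii) $H_{(-\infty,-1]}\cap H_{[0,\infty)}=\{0\}$.
   Context: A stationary process $\{X_k:k\in\mathbf{Z}\}$ is a real, zero-mean, weakly stationary process defined on a probability space $(\Omega,\mathcal{F},P)$. $H$ is the closed real linear span of $\{X_k:k\in\mathbf{Z}\}$ in $L^2(\Omega,\mathcal{F},P)$, a real Hilbert space with inner product $(Y,Z)=E[YZ]$ and norm $\|Y\|=E[Y^2]^{1/2}$. For integers $n\le m$, $H_{(-\infty,n]}$, $H_{[n,\infty)}$ and $H_{[n,m]}$ denote the closed subspaces of $H$ spanned by $\{X_k:-\infty<k\le n\}$, $\{X_k:n\le k<\infty\}$ and $\{X_k:n\le k\le m\}$, respectively. The process is nondeterministic if $X_0\notin H_{(-\infty,-1]}$.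
   Formalization: The process is additionally assumed not to be almost surely zero (H ≠ {0}); for the zero process condition (ii) holds but (i) fails, since X_0 = 0 lies in H_{(-∞,-1]}. *)

(* Defs.v *)
From HB Require Import structures.
From mathcomp Require Import all_boot all_order all_algebra.
From mathcomp Require Import all_classical all_reals all_analysis.
From mathcomp Require Import measurable_realfun.

Set Implicit Arguments.
Unset Strict Implicit.
Unset Printing Implicit Defensive.

Import Order.TTheory GRing.Theory Num.Theory.
Import numFieldNormedType.Exports.
Local Open Scope classical_set_scope.
Local Open Scope quotient_scope.
Local Open Scope ring_scope.

Section L2.
Context (d : measure_display) (T : measurableType d) (R : realType).
Variable P : probability T R.

(* [L2fun] consists of functions, [L2] of their classes modulo a.s. equality;
   the coercion of [Y : L2] to [T -> R] picks a representative. *)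
Definition L2fun := LfunType P (lee1n 2).
Definition L2 := LspaceType P (lee1n 2).

Section L2class.
Variable f : L2fun.

(* [measurableTypeR R] is [R] with another name for its Borel sigma-algebra. *)
Let g : T -> measurableTypeR R := f.

Let measurable_g : measurable_fun [set: T] g.
Proof. exact: (measurable_funPT f). Qed.

#[local] HB.instance Definition _ := @isMeasurableFun.Build _ _ _ _ g measurable_g.

Let q : {mfun_ P, T >-> measurableTypeR R} :=
  \pi_({mfun_ P, T >-> measurableTypeR R}) (g : {mfun T >-> measurableTypeR R}).

Let pi_L2fun_ae : (q : T -> R) = (f : T -> R) %[ae P].
Proof.
have : q == \pi_({mfun_ P, T >-> measurableTypeR R})
  (g : {mfun T >-> measurableTypeR R}) by [].
by rewrite -[X in X == _]reprK eqmodE => /asboolP.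
Qed.

Let pi_L2fun_finite_norm : finite_norm P 2%:R%:E (q : T -> R).
Proof.
have mq : measurable_fun [set: T] (q : T -> R).
  exact: (@measurable_funPT _ _ _ _ (repr q)).
rewrite /finite_norm (_ : Lnorm _ _ _ = 'N[P]_2%:R%:E[EFin \o f])%E; last first.
  rewrite unlock; congr (_ `^ _)%E.
  apply: ge0_ae_eq_integral => //.
  - apply: (measurableT_comp (measurable_poweR _)).
    by apply: measurableT_comp => //; exact/measurable_EFinP.
  - apply: (measurableT_comp (measurable_poweR _)).
    by apply: measurableT_comp => //; exact/measurable_EFinP.
  - by move=> x _; exact: poweR_ge0.
  - by move=> x _; exact: poweR_ge0.
  - by move: pi_L2fun_ae; apply: filterS => x /= /(_ I) ->.
exact: Lfunction_finite.
Qed.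

#[local] HB.instance Definition _ := isFinLebesgue.Build d T R P _ (lee1n 2) q
  pi_L2fun_finite_norm.

Definition L2class : L2 := q.

Lemma L2class_ae : (L2class : T -> R) = (f : T -> R) %[ae P].
Proof. exact: pi_L2fun_ae. Qed.

End L2class.

Lemma L2_eq_ae (Y Z : L2) : (Y : T -> R) = (Z : T -> R) %[ae P] -> Y = Z.
Proof.
case: Y Z => [Y [[pY]]] [Z [[pZ]]] /= YZ.
have E : Y = Z.
  have <- := @reprK _ {mfun_ P, T >-> measurableTypeR R} Y.
  have <- := @reprK _ {mfun_ P, T >-> measurableTypeR R} Z.
  by apply/eqP; rewrite eqmodE; exact/asboolP.
by move: pY pZ; rewrite {}E => pY pZ; rewrite (Prop_irrelevance pY pZ).
Qed.

Definition lspan (V : lmodType R) (A : set V) : set V :=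
  [set v | exists n (c : 'I_n -> R) (x : 'I_n -> V),
    (forall i, A (x i)) /\ v = \sum_(i < n) c i *: x i].

Definition L2closure (A : set L2fun) : set L2 :=
  [set Y | forall e : R, 0 < e -> exists2 f, A f &
    ('N[P]_2%:E[EFin \o ((Y : T -> R) \- (f : T -> R))%R] < e%:E)%E].

(* Closed linear span in L2 of {X_k : k in K}; it is contained in
   H = closed_span X setT, so its closure in L2 is its closure in H. *)
Definition closed_span (X : int -> L2fun) (K : set int) : set L2 :=
  L2closure (lspan (X @` K)).

Record stationary (X : int -> L2fun) : Prop := {
  stationary_mean0 : forall k : int, ('E_P[X k] = 0)%E;
  stationary_cov : forall j k h : int,
    ('E_P[X (j + h)%R \* X (k + h)%R] = 'E_P[X j \* X k])%E
}.

(* The zero process is not nondeterministic, although the closed spans of its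
   past and its future intersect in {0}. *)
Definition nondeterministic (X : int -> L2fun) : Prop :=
  ~ closed_span X `]-oo, (-1)] (L2class (X 0)).

End L2.

(* Main.v *)
(* (ii) => (i): a subspace spanned by finitely many vectors added to a closed
   subspace gives a closed subspace, so every f in H_[-n,oo) is g + h with g in
   H_[-n,-1] and h in H_[0,oo); if f is also in the past, so is h, hence h = 0.
   If X_0 were in the past it would be 0, and H would be {0} by stationarity.
   (i) => (ii): an element of the past and of the future is in H_[-1,-1], hence
   equal to c X_(-1); if c <> 0, then X_(-1) is in H_[0,oo), and the time
   reversal k |-> -1 - k, which preserves covariances, puts X_0 in the past. *)
Require Import Defs.
From mathcomp Require Import all_boot all_order all_algebra.
From mathcomp Require Import all_classical all_reals all_analysis.
From mathcomp Require Import measurable_realfun zify ring lra.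

Set Implicit Arguments.
Unset Strict Implicit.

Import Order.TTheory GRing.Theory Num.Theory.
Import numFieldNormedType.Exports.
Local Open Scope classical_set_scope.
Local Open Scope ring_scope.

(** * Linear subspaces and spans, with one generator split off *)

Section Subspaces.
Context {R : realType} {V : lmodType R}.
Implicit Types (A B : set V) (u v x y : V).

Definition subspace A : Prop :=
  A 0 /\ forall (a : R) u v, A u -> A v -> A (a *: u + v).

Lemma subspaceZ A (a : R) u : subspace A -> A u -> A (a *: u).
Proof. by move=> [A0 lA] Au; rewrite -[_ *: _]addr0; exact: lA. Qed.

Lemma subspaceD A u v : subspace A -> A u -> A v -> A (u + v).
Proof. by move=> [_ lA] Au Av; rewrite -[u]scale1r; exact: lA. Qed.

Lemma subspaceB A u v : subspace A -> A u -> A v -> A (u - v).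
Proof.
by move=> sA Au Av; apply: subspaceD => //; rewrite -scaleN1r; exact: subspaceZ.
Qed.

Lemma lspan_subspace A : subspace (lspan A).
Proof.
split; first by exists 0, (fun=> 0), (fun=> 0); split; [case|rewrite big_ord0].
move=> a u v [n [c [x [Ax ->]]]] [m [e [y [Ay ->]]]].
exists (n + m)%N,
  (fun k => match fintype.split k with inl i => a * c i | inr j => e j end),
  (fun k => match fintype.split k with inl i => x i | inr j => y j end).
split=> [k|]; first by case: (fintype.split k).
rewrite big_split_ord scaler_sumr; congr (_ + _); apply: eq_bigr => i _.
  by rewrite -[lshift _ _]/(unsplit (inl i)) unsplitK scalerA.
by rewrite -[rshift _ _]/(unsplit (inr i)) unsplitK.
Qed.

Lemma sub_lspan A : A `<=` lspan A.
Proof.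
move=> x Ax; exists 1%N, (fun=> 1), (fun=> x).
by split=> //; rewrite big_ord1 scale1r.
Qed.

Lemma lspan_min A B : subspace B -> A `<=` B -> lspan A `<=` B.
Proof.
move=> sB AB v [n [c [x [Ax ->]]]].
elim/big_ind : _ => [|u w|i _]; first by case: sB.
- exact: subspaceD.
- by apply: subspaceZ => //; exact: AB.
Qed.

Lemma lspanS A B : A `<=` B -> lspan A `<=` lspan B.
Proof.
by move=> AB; apply: lspan_min; [exact: lspan_subspace|move=> x /AB /sub_lspan].
Qed.

Lemma lspan_set0 : lspan (set0 : set V) `<=` [set 0].
Proof.
apply: lspan_min => //; split=> // a u v /= -> ->.
by rewrite scaler0 addr0.
Qed.

Lemma lspanU1 A x :
  lspan (x |` A) `<=` [set y | exists c : R, lspan A (y - c *: x)].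
Proof.
have sA := lspan_subspace A.
apply: lspan_min => [|y [->|Ay]].
- split; first by exists 0; rewrite scale0r subr0; case: sA.
  move=> a u v [c Ac] [e Ae]; exists (a * c + e).
  have -> : a *: u + v - (a * c + e) *: x = a *: (u - c *: x) + (v - e *: x).
    by rewrite scalerBr scalerDl scalerA opprD addrACA.
  by case: sA => _; exact.
- by exists 1; rewrite scale1r subrr; case: sA.
- by exists 0; rewrite scale0r subr0; exact: sub_lspan.
Qed.

End Subspaces.

(** * Closures of subspaces for a seminorm *)

Section Seminorm.
Context {R : realType} {V : lmodType R}.
Implicit Types (A B : set V) (u v x y : V).

(** The vectors will be functions rather than classes, so [N] may vanish off 0, and a closure of a
    set containing 0 contains every null vector. *)
Definition nclosure (N : V -> R) A : set V :=
  [set v | forall e : R, 0 < e -> exists2 a, A a & N (v - a) < e].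

Context {N : V -> R}.
Hypothesis ND : forall u v, N (u + v) <= N u + N v.
Hypothesis NZ : forall (a : R) u, N (a *: u) = `|a| * N u.

Lemma seminorm0 : N 0 = 0.
Proof. by rewrite -(scale0r 0) NZ normr0 mul0r. Qed.

Lemma seminormN u : N (- u) = N u.
Proof. by rewrite -scaleN1r NZ normrN1 mul1r. Qed.

Lemma seminormB u v : N (u - v) <= N u + N v.
Proof. by rewrite -(seminormN v) ND. Qed.

Lemma seminorm_ge0 u : 0 <= N u.
Proof. by have := seminormB u u; rewrite subrr seminorm0; lra. Qed.

Lemma sub_nclosure A : A `<=` nclosure N A.
Proof. by move=> v Av e e0; exists v => //; rewrite subrr seminorm0. Qed.

Lemma nclosureS A B : A `<=` B -> nclosure N A `<=` nclosure N B.
Proof. by move=> AB v Av e /Av[a /AB]; exists a. Qed.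

Lemma nclosure_null A u : A 0 -> N u = 0 -> nclosure N A u.
Proof. by move=> A0 u0 e e0; exists 0 => //; rewrite subr0 u0. Qed.

Lemma nclosure_set0_null u : nclosure N [set 0] u -> N u = 0.
Proof.
move=> u0; apply/eqP; rewrite eq_le seminorm_ge0 andbT.
apply/ler_addgt0Pr => e /u0[_ ->]; rewrite subr0 add0r => /ltW //.
Qed.

Lemma null_subspace : subspace [set u | N u = 0].
Proof.
split=> [|a u v /= u0 v0]; first exact: seminorm0.
have := ND (a *: u) v; rewrite NZ u0 v0 mulr0 addr0 => N0.
by apply/eqP; rewrite eq_le N0 seminorm_ge0.
Qed.

Lemma nclosure_subspace A : subspace A -> subspace (nclosure N A).
Proof.
move=> [A0 lA]; split; first exact: sub_nclosure.
move=> a u v Au Av e e0.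
(* The summand 1 keeps the tolerance for [u] meaningful when [a] is 0. *)
have a1 : 0 < `|a| + 1 by have := normr_ge0 a; lra.
have [|u' Au' uu'] := Au (e / 2 / (`|a| + 1)); first by rewrite !divr_gt0.
have [|v' Av' vv'] := Av (e / 2); first by rewrite divr_gt0.
exists (a *: u' + v'); first exact: lA.
have -> : a *: u + v - (a *: u' + v') = a *: (u - u') + (v - v').
  by rewrite scalerBr opprD addrACA.
rewrite (le_lt_trans (ND _ _))// [ltRHS]splitr ler_ltD// NZ.
have := uu'; rewrite ltr_pdivlMr// => /ltW; apply: le_trans.
rewrite mulrDr mulr1 mulrC lerDl; exact: seminorm_ge0.
Qed.

(* If [x] is at distance [r > 0] from [A], the coefficients of [x] in
   [e]- and [e']-approximations of [y] differ by at most [(e + e') / r], so the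
   intervals of radius [e / r] around them have a common point. *)
Lemma nclosure_line A x y : subspace A ->
  nclosure N [set v | exists c : R, A (v - c *: x)] y ->
  exists c : R, nclosure N A (y - c *: x).
Proof.
(* If [x] is itself in the closure of [A], so is every approximation [v] of [y], and the coefficient
   0 works. *)
move=> sA Ay; have [Ax|/existsNP[r]] := pselect (nclosure N A x).
  exists 0; rewrite scale0r subr0 => e e0.
  have [|v [c Avc] yv] := Ay (e / 2); first by rewrite divr_gt0.
  have clA := nclosure_subspace sA.
  have {Avc}Av : nclosure N A v.
    rewrite -(subrK (c *: x) v).
    exact: (subspaceD clA (sub_nclosure Avc) (subspaceZ c clA Ax)).
  have [|w Aw vw] := Av (e / 2); first by rewrite divr_gt0.
  exists w => //.
  have -> : y - w = (y - v) + (v - w) by rewrite addrA subrK.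
  by rewrite (le_lt_trans (ND _ _))// [ltRHS]splitr ltrD.
rewrite not_implyE => -[r0 xA].
have {}xA a : A a -> r <= N (x - a).
  by move=> Aa; rewrite leNgt; apply/negP => xa; apply: xA; exists a.
have close c e a c' e' a' : A a -> A a' -> N (y - (a + c *: x)) < e ->
    N (y - (a' + c' *: x)) < e' -> c - c' <= (e + e') / r.
  move=> Aa Aa' ye ye'; rewrite ler_pdivlMr//.
  have [cc'|cc'] := leP (c - c') 0.
    have := seminorm_ge0 (y - (a + c *: x)).
    have := seminorm_ge0 (y - (a' + c' *: x)).
    nra.
  (* The difference of the two errors is [c - c'] times [x] minus a vector of [A], so its norm is at
     least [(c - c') * r]. *)
  have := seminormB (y - (a' + c' *: x)) (y - (a + c *: x)).
  have -> : y - (a' + c' *: x) - (y - (a + c *: x)) =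
      (c - c') *: (x - (c - c')^-1 *: (a' - a)).
    rewrite scalerBr scalerA mulfV ?gt_eqF// scale1r opprB.
    by rewrite addrC subrKA scalerBl !opprB opprD addrACA addrC.
  rewrite NZ gtr0_norm//.
  have := xA _ (subspaceZ (c - c')^-1 sA (subspaceB sA Aa' Aa)).
  nra.
(* [S] collects the left endpoints of the intervals. By [close] each right endpoint bounds [S], so
   [sup S] lies in all of them. *)
pose S := [set t : R | exists c e a, [/\ 0 < e, A a,
  N (y - (a + c *: x)) < e & t = c - e / r]].
have approx e : 0 < e -> exists2 c, exists2 a, A a & N (y - (a + c *: x)) < e &
    S (c - e / r).
  move=> e0; have [v [c Avc] yv] := Ay _ e0.
  have yv' : N (y - ((v - c *: x) + c *: x)) < e by rewrite subrK.
  by exists c; [exists (v - c *: x)|exists c, e, (v - c *: x)].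
have ubS c e a : A a -> N (y - (a + c *: x)) < e -> ubound S (c + e / r).
  move=> Aa ye _ [c' [e' [a' [e'0 Aa' ye' ->]]]].
  by have := close _ _ _ _ _ _ Aa' Aa ye' ye; rewrite mulrDl; lra.
have supS : has_sup S.
  have [c [a Aa ye] Sc] := approx 1 ltr01.
  split; first by exists (c - 1 / r).
  by exists (c + 1 / r); exact: ubS ye.
exists (sup S) => e e0.
have x0 := seminorm_ge0 x.
(* Replacing the coefficient [c] by [sup S] costs at most [e1 / r * N x]; this choice makes the
   total error [e]. *)
pose e1 := e / (1 + N x / r).
have x1 : 0 < 1 + N x / r by have := divr_ge0 x0 (ltW r0); lra.
have e10 : 0 < e1 by rewrite divr_gt0.
have [c [a Aa ye] Sc] := approx _ e10.
exists a => //.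
have -> : y - sup S *: x - a = (y - (a + c *: x)) + (c - sup S) *: x.
  by rewrite scalerBl opprD !addrA subrK addrAC.
rewrite (le_lt_trans (ND _ _))// NZ.
have lec := sup_upper_bound supS Sc.
have gec := ge_sup supS.1 (ubS _ _ _ Aa ye).
have cs : `|c - sup S| <= e1 / r by rewrite ler_norml; apply/andP; split; lra.
have -> : e = e1 + e1 / r * N x by rewrite /e1; field; lra.
by rewrite ltr_leD// ler_wpM2r.
Qed.

Lemma nclosure_lspanU1 A x y : nclosure N (lspan (x |` A)) y ->
  exists c : R, nclosure N (lspan A) (y - c *: x).
Proof.
move=> Ay; apply: nclosure_line; first exact: lspan_subspace.
by apply: nclosureS Ay; exact: lspanU1.
Qed.

End Seminorm.

(** * Transfer of closed spans between families with equal Gram matrices *)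

Section Gram.
Context {R : realType} {V : lmodType R} {N : V -> R} {B : V -> V -> R}.
Hypothesis Bl : forall (a : R) u v w, B (a *: u + v) w = a * B u w + B v w.
Hypothesis BC : forall u v, B u v = B v u.
Hypothesis N_ge0 : forall u, 0 <= N u.
Hypothesis NB : forall u, N u ^+ 2 = B u u.

Lemma form0l w : B 0 w = 0.
Proof. by have := Bl 1 0 0 w; rewrite scaler0 addr0; lra. Qed.

(* [lspan G] is the graph of the linear isometry sending each [x k] to [y k]. *)
Lemma nclosure_gram {I : Type} (x y : I -> V) (J : set I) (i : I) :
  (forall j k, B (x j) (x k) = B (y j) (y k)) ->
  nclosure N (lspan (x @` J)) (x i) -> nclosure N (lspan (y @` J)) (y i).
Proof.
move=> gram; pose G : set (V * V)%type := range (fun k => (x k, y k)).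
have sG := lspan_subspace G.
(* The form is preserved in one argument at a time: first against generators, then, in [BG], against
   any pair of the graph. *)
have BxG k : lspan G `<=` [set p | B p.1 (x k) = B p.2 (y k)].
  apply: lspan_min => [|_ [j _ <-]]; last exact: gram.
  by split=> [|a u v /= Bu Bv]; rewrite /= ?form0l// !Bl Bu Bv.
have BG p : lspan G p -> lspan G `<=` [set q | B q.1 p.1 = B q.2 p.2].
  move=> Gp; apply: lspan_min => [|_ [j _ <-]]; last first.
    by rewrite /= BC [RHS]BC; exact: BxG.
  by split=> [|a u v /= Bu Bv]; rewrite /= ?form0l// !Bl Bu Bv.
have lift : lspan (x @` J) `<=`
    [set u | exists2 v, lspan (y @` J) v & lspan G (u, v)].
  have sy := lspan_subspace (y @` J).
  apply: lspan_min => [|_ [j Jj <-]]; last first.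
    by exists (y j); apply: sub_lspan; exists j.
  split; first by exists 0; [case: sy|case: sG].
  move=> a u v [u' yu' Gu] [v' yv' Gv].
  exists (a *: u' + v'); first exact: sy.2.
  exact: (sG.2 a _ _ Gu Gv).
move=> xi e /xi[u /lift[v yv Guv] xu]; exists v => //.
(* The pair of errors [(x i - u, y i - v)] is in the graph, so both errors have the same norm. *)
rewrite (le_lt_trans _ xu)// -ler_sqr ?nnegrE// !NB.
have Gxi : lspan G (x i, y i) by apply: sub_lspan; exists i.
have Gd := subspaceB sG Gxi Guv.
by rewrite (BG _ Gd _ Gd).
Qed.

End Gram.

(** * Square-integrable functions and their classes *)

Section L2.
Context {d : measure_display} {T : measurableType d} {R : realType}.
Context {P : probability T R}.
Implicit Types (f g h : L2fun P) (Y : L2 P).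

Definition L2norm f : R := fine ('N[P]_2%:E[EFin \o f])%E.

Definition L2inner f g : R := fine ('E_P[f \* g])%E.

Lemma L2normD f g : L2norm (f + g) <= L2norm f + L2norm g.
Proof. exact: ler_LnormD. Qed.

Lemma L2normZ (a : R) f : L2norm (a *: f) = `|a| * L2norm f.
Proof.
by apply: EFin_inj; rewrite EFinM !finite_norm_fine; exact: LnormZ.
Qed.

Lemma L2innerC f g : L2inner f g = L2inner g f.
Proof.
rewrite /L2inner; congr (fine 'E_P[_])%E.
by apply/funext => t /=; rewrite mulrC.
Qed.

Lemma L2inner_linearl (a : R) f g h :
  L2inner (a *: f + g) h = a * L2inner f h + L2inner g h.
Proof.
have L1 u v : (u : L2fun P) \* (v : L2fun P) \in Lfun P 1.
  by apply: Lfun2_mul_Lfun1; exact: LfunP.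
rewrite /L2inner -[X in X * _]/(fine a%:E) -fineM ?expectation_fin_num//.
rewrite -expectationZl// -fineD ?expectation_fin_num ?Lfun_scale//.
rewrite -expectationD ?Lfun_scale//; congr (fine 'E_P[_])%E.
apply/funext => t; rewrite -[LHS]/((a * f t + g t) * h t) mulrDl /=.
by rewrite -mulrA mulrC.
Qed.

Lemma L2norm_sqr f : L2norm f ^+ 2 = L2inner f f.
Proof.
apply: EFin_inj; rewrite fineK; last first.
  by apply: expectation_fin_num; apply: Lfun2_mul_Lfun1; exact: LfunP.
have -> : (L2norm f ^+ 2)%:E = ('N[P]_2%:E[EFin \o f] `^ 2)%E.
  rewrite -finite_norm_fine poweR_EFin powR_mulrn//.
  by apply: fine_ge0; exact: Lnorm_ge0.
rewrite powR_Lnorm// unlock; apply: eq_integral => t _ /=.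
by rewrite powR_mulrn// real_normK ?num_real// expr2.
Qed.

Lemma measurable_L2 Y : measurable_fun [set: T] (Y : T -> R).
Proof.
exact: (@measurable_funPT _ _ _ _
  (repr (Y : {mfun_ P, T >-> measurableTypeR R}))).
Qed.

(** A representative of [Y] is itself square-integrable. This reduces statements about classes to
    functions. *)
Lemma L2class_surj Y : exists f, Y = L2class f.
Proof.
have Yf : (Y : T -> R) \in Lfun P 2%:E.
  apply/andP; split; rewrite inE/=.
    exact: measurable_L2.
  exact: Lebesgue_finite.
exists (Lfun_Sub (lee1n 2) Yf); apply: L2_eq_ae.
by have := L2class_ae (Lfun_Sub (lee1n 2) Yf); apply: filterS => t /[apply] ->.
Qed.

(** The representative of the class of [f] equals [f] almost surely, and the integral ignores null
    sets. *)
Lemma L2norm_class f g : ('N[P]_2%:E[EFin \o ((L2class f : T -> R) \- g)%R])%E =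
  (L2norm (f - g))%:E.
Proof.
have mpow (u : T -> R) : measurable_fun [set: T] u ->
    measurable_fun [set: T] (fun t => `|(EFin \o u) t| `^ 2)%E.
  move=> mu; apply: (measurableT_comp (measurable_poweR _)).
  by apply: measurableT_comp => //; exact/measurable_EFinP.
rewrite [RHS]finite_norm_fine unlock.
apply: (congr1 (fun x => x `^ _)%E); apply: ge0_ae_eq_integral.
- exact: measurableT.
- by apply/mpow/measurable_funB => //; exact: measurable_L2.
- exact: mpow.
- by move=> t _; exact: poweR_ge0.
- by move=> t _; exact: poweR_ge0.
- by have := L2class_ae f; apply: filterS => t /= /(_ I) ->.
Qed.

Lemma L2class_eq0 f : L2class f = L2class (0 : L2fun P) <-> L2norm f = 0.
Proof.
split=> [f0|].
  have := L2norm_class f 0; rewrite f0 L2norm_class !subr0 => -[<-].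
  exact: (seminorm0 L2normZ).
move=> /fine_Lnormr_eq0 f0; apply: L2_eq_ae.
have := L2class_ae f; have := L2class_ae (0 : L2fun P); move: f0.
by apply: filterS3 => t f0 c0 cf tT; rewrite c0// cf// f0.
Qed.

Lemma closed_spanE (X : int -> L2fun P) (K : set int) f :
  closed_span X K (L2class f) <-> nclosure L2norm (lspan (X @` K)) f.
Proof.
by split=> Kf e /Kf[a Aa] fa; exists a => //; move: fa;
  rewrite L2norm_class lte_fin.
Qed.

End L2.

(** * Closed spans of the process: splitting and time reversal *)

Section Stationary.
Context {d : measure_display} {T : measurableType d} {R : realType}.
Context {P : probability T R} {X : int -> L2fun P}.

Local Notation cl K := (nclosure L2norm (lspan (X @` K))).

Lemma cl_subspace K : subspace (cl K).
Proof. exact: (nclosure_subspace L2normD L2normZ (lspan_subspace _)). Qed.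

Lemma sub_cl K : X @` K `<=` cl K.
Proof. by move=> v Kv; apply: (sub_nclosure L2normZ); exact: sub_lspan. Qed.

Lemma clS K L : K `<=` L -> cl K `<=` cl L.
Proof. by move=> KL; apply/nclosureS/lspanS/image_subset. Qed.

Lemma cl_null {K} f : L2norm f = 0 -> cl K f.
Proof. by apply: nclosure_null; exact: (lspan_subspace _).1. Qed.

(** Induction on [n], removing the earliest variable each time. Its coefficient is exact, so [g]
    stays in the plain span and only the remainder needs a closure. *)
Lemma closed_span_split (n : nat) f : cl `[- n%:Z, +oo[ f ->
  exists2 g, lspan (X @` `[- n%:Z, (-1)]) g & cl `[0, +oo[ (f - g).
Proof.
elim: n f => [|n IHn] f fcl.
  exists 0; first exact: (lspan_subspace _).1.
  by rewrite subr0; exact: fcl.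
have [|c {}fcl] := @nclosure_lspanU1 _ _ _ L2normD L2normZ
    (X @` `[- n%:Z, +oo[) (X (- n.+1%:Z)) f.
  apply: nclosureS fcl; apply: lspanS => _ [k + <-].
  rewrite /= in_itv /= andbT => nk.
  have [->|kn] := eqVneq k (- n.+1%:Z); first by left.
  by right; exists k => //=; rewrite in_itv /=; lia.
have [g gn fg] := IHn _ fcl; exists (c *: X (- n.+1%:Z) + g); last first.
  by rewrite opprD addrA.
apply: (lspan_subspace _).2.
  by apply: sub_lspan; exists (- n.+1%:Z) => //=; rewrite in_itv /=; lia.
apply: lspanS gn; apply: image_subset => k; rewrite /= !in_itv /=; lia.
Qed.

Hypothesis statX : stationary X.

Lemma L2inner_shift (j k h : int) :
  L2inner (X (j + h)) (X (k + h)) = L2inner (X j) (X k).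
Proof. by rewrite /L2inner (stationary_cov statX). Qed.

Lemma L2norm_stationary (k : int) : L2norm (X k) = L2norm (X 0).
Proof.
apply/eqP; rewrite -(@eqrXn2 _ 2)//; try exact: (seminorm_ge0 L2normD L2normZ).
by rewrite !L2norm_sqr -(L2inner_shift 0 0 k) add0r.
Qed.

Lemma closed_span_reverse : cl `[0, +oo[ (X (-1)) -> cl `]-oo, (-1)] (X 0).
Proof.
move=> X1; pose Y k := X (-1 - k).
have gram j k : L2inner (X j) (X k) = L2inner (Y j) (Y k).
  (* The shift by [-1 - j - k] sends [k] to [-1 - j] and [j] to [-1 - k]; the symmetry of the form
     undoes the exchange. *)
  rewrite L2innerC -(L2inner_shift k j (-1 - j - k)) /Y.
  by congr (L2inner (X _) (X _)); lia.
have := nclosure_gram L2inner_linearl L2innerC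
  (seminorm_ge0 L2normD L2normZ) L2norm_sqr gram X1.
(* [Y (-1)] is [X 0], and [Y] carries the indices [k >= 0] to the indices at most -1. *)
rewrite [X in nclosure _ _ X](_ : _ = X 0)//.
apply/nclosureS/lspanS => _ [k + <-]; rewrite /= in_itv /= andbT => k0.
by exists (-1 - k) => //=; rewrite in_itv /=; lia.
Qed.

End Stationary.

Theorem theorem2p3 (d : measure_display) (T : measurableType d) (R : realType)
    (P : probability T R) (X : int -> L2fun P) (statX : stationary X)
    (H_neq0 : closed_span X [set: int] <> [set L2class (0 : L2fun P)]) :
  (nondeterministic X /\
   forall n : nat, (1 <= n)%N ->
     closed_span X `]-oo, (-1)] `&` closed_span X `[- n%:Z, +oo[ =
     closed_span X `[- n%:Z, (-1)])
  <->
  closed_span X `]-oo, (-1)] `&` closed_span X `[0, +oo[ =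
  [set L2class (0 : L2fun P)].
Proof.
split=> [[nd capn]|cap0].
  apply/seteqP; split=> Y; last first.
    by move=> ->; split; apply/closed_spanE/cl_null/(seminorm0 L2normZ).
  have [f ->] := L2class_surj Y => -[/closed_spanE past /closed_spanE future].
  apply/L2class_eq0.
  have : closed_span X `[- 1%:Z, (-1)] (L2class f).
    rewrite -(capn 1%N)//; split; apply/closed_spanE => //.
    apply: clS future => k; rewrite /= !in_itv /=; lia.
  move=> /closed_spanE f1.
  (* The interval from -1 to -1 leaves the single generator [X (-1)] over the empty set, so the
     remainder is null. *)
  have [|c fc] := @nclosure_lspanU1 _ _ _ L2normD L2normZ set0 (X (-1)) f.
    apply: nclosureS f1; apply: lspanS => _ [k + <-].
    by rewrite /= in_itv /= => k1; left; congr X; lia.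
  have {}fc : L2norm (f - c *: X (-1)) = 0.
    apply: (nclosure_set0_null L2normD L2normZ).
    by apply: nclosureS fc; exact: lspan_set0.
  have [c0|c0] := eqVneq c 0; first by move: fc; rewrite c0 scale0r subr0.
  case: nd; apply/closed_spanE; apply: closed_span_reverse => //.
  (* The subtracted vector is null but perhaps not the zero function; it lies in every closed
     span. *)
  have -> : X (-1) = c^-1 *: (f - (f - c *: X (-1))).
    by rewrite subKr scalerA mulVf// scale1r.
  apply: (subspaceZ _ (cl_subspace _)).
  exact: (subspaceB (cl_subspace _) future (cl_null fc)).
split=> [/closed_spanE X0past|n n1]; last first.
  apply/seteqP; split=> Y; have [f ->] := L2class_surj Y.
    move=> [/closed_spanE past /closed_spanE/closed_span_split[g gn fg]].
    apply/closed_spanE.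
    (* [g] combines variables of the past, so [f - g] is in the past along with [f]. *)
    have : (closed_span X `]-oo, (-1)] `&` closed_span X `[0, +oo[)
        (L2class (f - g)).
      split; apply/closed_spanE => //; apply: (subspaceB (cl_subspace _)) => //.
      apply: (sub_nclosure L2normZ); apply: lspanS gn; apply: image_subset => k.
      by rewrite /= !in_itv /=; lia.
    rewrite cap0 => /L2class_eq0 fg0 e e0; exists g => //.
    by rewrite fg0.
  move=> /closed_spanE fn; split; apply/closed_spanE; apply: clS fn => k;
    rewrite /= !in_itv /=; lia.
have X00 : L2norm (X 0) = 0.
  apply/L2class_eq0; rewrite -[_ = _]/([set _] _) -cap0.
  by split; apply/closed_spanE => //; apply: sub_cl; exists 0.
apply: H_neq0; apply/seteqP; split=> Y; last first.
  by move=> ->; apply/closed_spanE/cl_null/(seminorm0 L2normZ).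
have [f ->] := L2class_surj Y => /closed_spanE fX; apply/L2class_eq0.
(* Every [X k] has the norm of [X 0], which is 0, so each combination [a] is null and 0 approximates
   [f] as well as [a] does. *)
apply: (nclosure_set0_null L2normD L2normZ) => e /fX[a aX fa].
exists 0 => //; rewrite subr0 -(subrK a f) (le_lt_trans (L2normD _ _))//.
suff -> : L2norm a = 0 by rewrite addr0.
move: a aX {fa}; apply: lspan_min; first exact: (null_subspace L2normD L2normZ).
by move=> _ [k _ <-] /=; rewrite L2norm_stationary.
Qed.
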